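(* For every integer $n \ge 3$, $\operatorname{hc}(n,3) \ge (n-2)!\,2^{\binom{n-1}{2}}$.
   Context: Graphs are finite and without loops; parallel edges are allowed. For such a graph $G$, the cycle matroid $M_G$ has ground set $E(G)$, and its bases are the edge sets of the spanning trees of $G$. For a matroid $M$, its basis graph $\operatorname{BG}(M)$ has the bases of $M$ as vertices, two bases $B, B'$ being adjacent if and only if $|B\triangle B'|=2$. For an edge $\epsilon$ of $\operatorname{BG}(M)$, let $\operatorname{HC}_\epsilon(M)$ be the number of distinct Hamiltonian cycles of $\operatorname{BG}(M)$ containing $\epsilon$. Define $\operatorname{HC}^*(M)=\min\{\operatorname{HC}_\epsilon(M) : \epsilon \in E(\operatorname{BG}(M))\}$. Define $\operatorname{hc}(n,k)=\min\{\operatorname{HC}^*(M_G) : G \text{ a $k$-edge-connected graph of order } n\}$. *)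

(* Defs.v *)
From HB Require Import structures.
From mathcomp Require Import all_boot.
From mathcomp Require Import boolp.

Set Implicit Arguments.
Unset Strict Implicit.
Unset Printing Implicit Defensive.

(* Least element of a set of natural numbers; 0 if the set is empty. *)
Definition nat_min (P : nat -> Prop) : nat :=
  if pselect (exists n, `[< P n >]) is left exP then ex_minn exP else 0.

Lemma nat_minP (P : nat -> Prop) :
  (exists n, P n) -> P (nat_min P) /\ forall m, P m -> nat_min P <= m.
Proof.
move=> [n Pn]; rewrite /nat_min; case: pselect => [exP|[]]; last first.
  by exists n; apply/asboolP.
case: ex_minnP => m /asboolP Pm m_min; split=> // p Pp.
by apply: m_min; apply/asboolP.
Qed.

Lemma nat_min_empty (P : nat -> Prop) : ~ (exists n, P n) -> nat_min P = 0.
Proof.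
move=> nP; rewrite /nat_min; case: pselect => // exP; exfalso.
by case: exP => n /asboolP Pn; apply: nP; exists n.
Qed.

Section HamiltonianCycles.
Variables (T : finType) (r : rel T).

Definition graph_edges : {set {set T}} := [set [set p.1; p.2] | p : T * T & r p.1 p.2].

(* A Hamiltonian cycle is identified with its edge set, so that orderings of
   the vertices differing by a rotation or a reversal are counted once. *)
Definition hamiltonian_cycle (C : {set {set T}}) : bool :=
  [exists s : #|T|.-tuple T,
    [&& 2 < #|T|, uniq s, cycle r s & C == [set [set x; next s x] | x in T]]].

Definition HC_edge (eps : {set T}) : nat :=
  #|[set C : {set {set T}} | hamiltonian_cycle C & eps \in C]|.

End HamiltonianCycles.

Record matroid (E : finType) := Matroid {
  bases : {set {set E}};
  bases_neq0 : bases != set0;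
  bases_exchange : forall B1 B2, B1 \in bases -> B2 \in bases ->
    forall e, e \in B1 :\: B2 ->
      exists2 f, f \in B2 :\: B1 & f |: (B1 :\ e) \in bases }.

Section BasisGraph.
Variables (E : finType) (M : matroid E).

Definition basis : finType := {B : {set E} | B \in bases M}.

Definition basis_adj : rel basis := fun B B' =>
  #|(val B :\: val B') :|: (val B' :\: val B)| == 2.

Definition HC_star : nat :=
  nat_min (fun m => exists2 eps, eps \in graph_edges basis_adj &
                                 m = HC_edge basis_adj eps).

End BasisGraph.

(* Loopless multigraphs: distinct edges may have the same pair of ends. *)
Record mgraph := MGraph {
  vertex : finType;
  edge : finType;
  ends : edge -> {set vertex};
  card_ends : forall e, #|ends e| = 2 }.

Section MGraphTheory.
Variable G : mgraph.
Implicit Types (F : {set edge G}) (e f : edge G) (x y u v : vertex G).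

Definition adj F : rel (vertex G) := fun x y =>
  [exists e in F, ends e == [set x; y]].

Definition spanning_connected F : Prop := forall x y, connect (adj F) x y.

Definition mg_connected : Prop := spanning_connected [set: edge G].

Definition k_edge_connected (k : nat) : Prop :=
  1 < #|vertex G| /\ forall F, #|F| < k -> spanning_connected (~: F).

Definition mg_step : rel (vertex G * edge G) :=
  fun p q => ends p.2 == [set p.1; q.1].

(* In a cycle given by the sequence [:: (x_1, e_1); ...; (x_m, e_m)] the edge
   e_i joins x_i to x_(i+1), indices being taken cyclically; two parallel edges
   form a cycle with m = 2. *)
Definition mg_cycle (s : seq (vertex G * edge G)) : bool :=
  [&& 1 < size s, uniq (unzip1 s), uniq (unzip2 s)
    & cycle mg_step s].

Definition acyclic F : Prop :=
  forall s, mg_cycle s -> ~ {subset unzip2 s <= F}.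

Definition spanning_tree F : Prop := spanning_connected F /\ acyclic F.

Definition spanning_trees : {set {set edge G}} :=
  [set F : {set edge G} | `[< spanning_tree F >]].

Lemma adj_sym F : symmetric (adj F).
Proof. by move=> x y; rewrite /adj setUC. Qed.

Lemma conn_sym F : connect_sym (adj F).
Proof. exact/sym_connect_sym/adj_sym. Qed.

Lemma adjS F F' : F \subset F' -> subrel (connect (adj F)) (connect (adj F')).
Proof.
move=> /subsetP sF; apply: connect_sub => x y /existsP[e /andP[eF eE]].
by apply: connect1; apply/existsP; exists e; rewrite sF.
Qed.

Lemma endsP e : exists x y, x != y /\ ends e = [set x; y].
Proof.
have /eqP/cards2P[x [y [xy ->]]] := card_ends e.
by exists x, y.
Qed.

Lemma eq_pair2 x y u v :
  [set x; y] = [set u; v] -> (x = u /\ y = v) \/ (x = v /\ y = u).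
Proof.
move=> eqS.
have xS : x \in [set u; v] by rewrite -eqS !inE eqxx.
have yS : y \in [set u; v] by rewrite -eqS !inE eqxx orbT.
have uS : u \in [set x; y] by rewrite eqS !inE eqxx.
have vS : v \in [set x; y] by rewrite eqS !inE eqxx orbT.
move: xS yS uS vS; rewrite !inE.
do 4 (case/orP=> /eqP ?); subst; auto.
Qed.

Lemma path_connect F p q t : path mg_step q (rcons t p) ->
  {subset unzip2 (q :: t) <= F} -> connect (adj F) q.1 p.1.
Proof.
elim: t q => [|a t IHt] q /=.
  rewrite andbT => Rqp sF; apply: connect1; apply/existsP; exists q.2.
  by rewrite (sF q.2) ?inE ?eqxx.
move=> /andP[Rqa pth] sF; apply: (@connect_trans _ _ a.1); last first.
  by apply: IHt => // f fat; apply: sF; rewrite inE fat orbT.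
apply: connect1; apply/existsP; exists q.2.
by rewrite (sF q.2) ?inE ?eqxx.
Qed.

Lemma cycle_connect F e s x y : mg_cycle s -> {subset unzip2 s <= F} ->
  e \in unzip2 s -> ends e = [set x; y] -> connect (adj (F :\ e)) x y.
Proof.
move=> /and4P[s2 u1 u2 cyc] sF /mapP[p ps ->{e}] ep.
have [i s' defs] := rot_to ps.
move: s2 u2 cyc; rewrite -(size_rot i) -(rot_uniq i) -map_rot -(rot_cycle i).
rewrite defs; case: s' defs => [|q t] //= defs _ /and3P[pq _ _] /andP[Rpq pth].
have sF' : {subset unzip2 (q :: t) <= F :\ p.2}.
  move=> f fqt; rewrite !inE; apply/andP; split.
    by apply: contraNneq pq => <-.
  by apply: sF; rewrite -(mem_rot i) -map_rot defs inE fqt orbT.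
have qp := path_connect pth sF'.
move/eqP: Rpq; rewrite ep => /eq_pair2[] [-> ->] //.
by rewrite conn_sym.
Qed.

Lemma path_lift F x p : path (adj F) x p -> uniq (x :: p) ->
  exists t, [/\ unzip1 t = belast x p, uniq (unzip2 t),
    {subset unzip2 t <= F},
    (forall f, f \in unzip2 t -> {subset ends f <= x :: p}) &
    forall a g, ends a.2 = [set a.1; x] -> path mg_step a (rcons t (last x p, g))].
Proof.
elim: p x => [|q p IHp] x.
  move=> _ _; exists [::]; split=> // a g ea.
  by rewrite /= andbT /mg_step ea.
rewrite [path _ _ _]/= => /andP[/existsP[e /andP[eF /eqP ee]] pth] /andP[xqp uqp].
have [t [t1 t2 tF te tR]] := IHp _ pth uqp.
exists ((x, e) :: t); split=> /=.
- by rewrite t1.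
- rewrite t2 andbT; apply: contra xqp => /te; apply.
  by rewrite ee !inE eqxx.
- by move=> f; rewrite inE => /predU1P[->//|/tF].
- move=> f; rewrite inE => /predU1P[->|/te ft] z.
    rewrite ee !inE => /orP[/eqP->|/eqP->]; rewrite ?eqxx ?orbT //.
  by move/ft => zqp; rewrite inE zqp orbT.
- move=> a g ea; rewrite /mg_step /= ea eqxx /=.
  exact: tR.
Qed.

Lemma connect_cycle F e x y : e \in F -> ends e = [set x; y] ->
  connect (adj (F :\ e)) x y ->
  exists2 s, mg_cycle s & {subset unzip2 s <= F}.
Proof.
move=> eF ee /connectP[p0 pth0 yl0].
case: (shortenP pth0) yl0 => p pth up _ yl {p0 pth0}.
have [t [t1 t2 tF _ tR]] := path_lift pth up.
exists ((y, e) :: t); last first.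
  move=> f; rewrite inE => /predU1P[->//|/tF].
  by rewrite !inE => /andP[].
apply/and4P; split.
- case: t t1 {t2 tF tR} => //; case: p {pth up} yl => //= yx.
  by have := card_ends e; rewrite ee yx setUid cards1.
- by rewrite /= t1; move: up; rewrite lastI -yl rcons_uniq.
- rewrite /= t2 andbT; apply/negP => /tF.
  by rewrite !inE eqxx.
- rewrite /= {2}yl; apply: tR.
  by rewrite ee setUC.
Qed.

Lemma acyclicP F : acyclic F <-> forall e x y, e \in F ->
  ends e = [set x; y] -> ~ connect (adj (F :\ e)) x y.
Proof.
split=> [acF e x y eF ee cxy|brF s cs sF].
  by have [s cs sF] := connect_cycle eF ee cxy; apply: acF cs sF.
case: s cs sF => [|[u e] s] // cs sF.
have [x [y [_ ee]]] := endsP e.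
have es : e \in unzip2 ((u, e) :: s) by rewrite inE eqxx.
exact: (brF e x y (sF _ es) ee (cycle_connect cs sF es ee)).
Qed.

Lemma spanning_trees_neq0 : mg_connected -> spanning_trees != set0.
Proof.
move=> cG.
have [F /minsetP[/asboolP cF minF]] :
    {F | minset (fun F : {set edge G} => `[< spanning_connected F >]) F}.
  by apply: ex_minset; exists setT; apply/asboolP.
apply/set0Pn; exists F; rewrite inE; apply/asboolP; split=> //.
apply/acyclicP => e x y eF ee cxy.
suff /minF : `[< spanning_connected (F :\ e) >].
  move=> /(_ (subD1set _ _)) eqF; move: eF.
  by rewrite -eqF !inE eqxx.
apply/asboolP => u v; apply: connect_sub (cF u v) => a b.
move=> /existsP[f /andP[fF /eqP ef]].
have [fe|fe] := eqVneq f e; last first.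
  by apply: connect1; apply/existsP; exists f; rewrite !inE fe fF ef /=.
move: ef; rewrite fe ee => /eq_pair2[] [<- <-] //.
by rewrite conn_sym.
Qed.

Lemma connectD1 F e x y u : spanning_connected F -> ends e = [set x; y] ->
  connect (adj (F :\ e)) x u \/ connect (adj (F :\ e)) y u.
Proof.
move=> cF ee; have /connectP[p pth ->] := cF x u.
elim/last_ind: p pth => [|p b IHp]; first by left.
rewrite rcons_path last_rcons => /andP[/IHp{}IHp].
move: (last x p) IHp => a IHp /existsP[f /andP[fF /eqP ef]].
have [fe|fe] := eqVneq f e.
  move: ef; rewrite fe ee => /eq_pair2[] [eqx eqy].
    by right; rewrite eqy connect0.
  by left; rewrite eqx connect0.
have ab : connect (adj (F :\ e)) a b.
  by apply: connect1; apply/existsP; exists f; rewrite !inE fe fF ef /=.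
by case: IHp => ca; [left|right]; apply: connect_trans ca ab.
Qed.

Lemma spanning_trees_exchange F1 F2 :
  F1 \in spanning_trees -> F2 \in spanning_trees ->
  forall e, e \in F1 :\: F2 ->
    exists2 f, f \in F2 :\: F1 & f |: (F1 :\ e) \in spanning_trees.
Proof.
rewrite !inE => /asboolP[c1 a1] /asboolP[c2 a2] e.
rewrite inE => /andP[eF2 eF1].
have [x [y [_ ee]]] := endsP e.
pose H := F1 :\ e.
have nxy : ~ connect (adj H) x y by have /acyclicP := a1; apply.
have [f [a [b [fF2 ef xa xb]]]] : exists f a b,
    [/\ f \in F2, ends f = [set a; b], connect (adj H) x a
      & ~ connect (adj H) x b].
  have /connectP[p pth yl] := c2 x y; rewrite {}yl in nxy.
  elim/last_ind: p pth nxy => [_ /=|p b IHp]; first by case; exact: connect0.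
  rewrite rcons_path last_rcons => /andP[pth pb] nb.
  have [xa|/negP xa] := boolP (connect (adj H) x (last x p)); last exact: IHp.
  case/existsP: pb => f /andP[fF2 /eqP ef].
  by exists f, (last x p), b.
have fe : f != e by apply: contraNneq eF2 => <-.
have fF1 : f \notin F1.
  apply/negP => fF1; apply: xb; apply: connect_trans xa _.
  by apply: connect1; apply/existsP; exists f; rewrite !inE fe fF1 ef /=.
have yb : connect (adj H) y b by case: (connectD1 b c1 ee).
exists f; first by rewrite inE fF1.
rewrite inE; apply/asboolP; split.
  have sH : subrel (connect (adj H)) (connect (adj (f |: H))).
    by apply: adjS; exact: subsetUr.
  have cab : connect (adj (f |: H)) a b.
    by apply: connect1; apply/existsP; exists f; rewrite !inE eqxx ef /=.
  have cx u : connect (adj (f |: H)) x u.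
    case: (connectD1 u c1 ee) => [/sH//|/sH]; apply: connect_trans.
    apply: (connect_trans (sH _ _ xa)); apply: (connect_trans cab).
    by rewrite conn_sym; apply: sH.
  by move=> u v; apply: connect_trans (cx v); rewrite conn_sym.
move=> s cs sF; have [fs|fs] := boolP (f \in unzip2 s).
  have cab := cycle_connect cs sF fs ef.
  apply: xb; apply: connect_trans xa _; apply: adjS cab.
  by apply/subsetP => g; rewrite !inE => /andP[/negPf-> /=].
apply: (a1 s cs) => g gs; have := sF _ gs.
rewrite !inE => /predU1P[gf|/andP[]//].
by rewrite -gf gs in fs.
Qed.

Definition cycle_matroid (cG : mg_connected) : matroid (edge G) :=
  Matroid (spanning_trees_neq0 cG) spanning_trees_exchange.

End MGraphTheory.

(* The cycle matroid is defined from spanning trees, hence for connected graphs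
   only; connectedness follows from k_edge_connected as soon as 0 < k. *)
Definition hc (n k : nat) : nat :=
  nat_min (fun m => exists (G : mgraph) (cG : mg_connected G),
    [/\ k_edge_connected G k, #|vertex G| = n & m = HC_star (cycle_matroid cG)]).

Lemma k_edge_connectedW (G : mgraph) (k : nat) :
  0 < k -> k_edge_connected G k -> mg_connected G.
Proof.
move=> k0 [_ /(_ set0)]; rewrite cards0 setC0; exact.
Qed.

(* Main.v *)
Require Import Defs.
From mathcomp Require Import all_boot.
From mathcomp Require Import zify boolp.

Set Implicit Arguments.
Unset Strict Implicit.
Unset Printing Implicit Defensive.

(* Contraction and deletion of e are replaced by the subfamilies of the
   bases containing e ([fcon]) and avoiding e ([fdel]), so that contracted
   elements become coloops and the rank is the number of non-coloops
   ([free]) in a basis. If e lies in two adjacent bases X and Y and is not a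
   coloop, a Hamiltonian path from X to Y in the basis graph of [fcon F e]
   is extended to one for F by cutting it at an edge UV and inserting a
   Hamiltonian path from U' to V' of [fdel F e], where U, U', V', V form a
   4-cycle. Different choices of the first path, of the edge UV and of the
   second path give different results.

   Such a square exists at some edge UV of the path, unless [fdel F e] is a
   single basis, which is then adjacent to all members of [fcon F e]; this
   gives one Hamiltonian path between adjacent bases of any matroid. If it
   exists at every edge ([squares]), a family of rank r has at least r bases
   in [fcon F e] and one gets (r-1)! paths. For the spanning trees of a
   3-edge-connected graph, of rank r = n - 1, deleting e yields such a
   family of the same rank: otherwise there would be a U_{2,4} minor. As
   each element of a tree can be exchanged in at least two ways, [fcon F e]
   has at least 2(r-1)+1 members, and the number h(r) of paths satisfies
   h(r) >= h(r-1) * 2(r-1) * (r-1)! >= h(r-1) * (r-1) * 2^(r-1). *)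

(** * Set families with the basis exchange property *)

Section Families.
Variable E : finType.
Implicit Types (F : {set {set E}}) (A B U V X Y Z : {set E}).
Implicit Types (s Q : seq {set E}).

Definition exchange F := forall A B, A \in F -> B \in F ->
  forall e, e \in A :\: B -> exists2 f, f \in B :\: A & f |: (A :\ e) \in F.

Definition swap A x y := y |: (A :\ x).

(** The formula of [basis_adj], on bare sets so that a family and all its subfamilies share one
    relation. *)
Definition sadj : rel {set E} := fun A B => #|(A :\: B) :|: (B :\: A)| == 2.

Definition fcon F e := [set A in F | e \in A].
Definition fdel F e := [set A in F | e \notin A].
Definition free F : {set E} := [set x | [exists A in F, x \notin A]].

Lemma freeP F x : reflect (exists2 A, A \in F & x \notin A) (x \in free F).
Proof.
by rewrite inE; apply: (iffP existsP) => [[A /andP[]]|[A ? ?]]; exists A => //;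
  apply/andP.
Qed.

Lemma free_sub F F' : F \subset F' -> free F \subset free F'.
Proof.
move=> /subsetP sF; apply/subsetP => x /freeP[A AF xA]; apply/freeP.
by exists A => //; apply: sF.
Qed.

Lemma fcon_sub F e : fcon F e \subset F.
Proof. by apply/subsetP => A; rewrite inE => /andP[]. Qed.

Lemma fdel_sub F e : fdel F e \subset F.
Proof. by apply/subsetP => A; rewrite inE => /andP[]. Qed.

Lemma sadj_sym : symmetric sadj.
Proof. by move=> A B; rewrite /sadj setUC. Qed.

Lemma sadj_irr A : sadj A A = false.
Proof. by rewrite /sadj setDv setU0 cards0. Qed.

Lemma sadj_swap A x y : x \in A -> y \notin A -> sadj A (swap A x y).
Proof.
move=> xA yA.
have xy : x != y by apply: contraNneq yA => <-.
suff -> : sadj A (swap A x y) = (#|[set x; y]| == 2) by rewrite cards2 xy.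
congr (#|pred_of_set _| == 2); apply/setP => z; rewrite !inE.
case: (eqVneq z x) => [->|zx]; first by rewrite xA (negPf xy).
case: (eqVneq z y) => [->|zy]; first by rewrite (negPf yA).
by case: (z \in A).
Qed.

Lemma card_swap A x y : x \in A -> y \notin A -> #|swap A x y| = #|A|.
Proof.
move=> xA yA; rewrite cardsU1 !inE (negPf yA) andbF /=.
by rewrite (cardsD1 x A) xA.
Qed.

Lemma sadjP A B : #|A| = #|B| -> sadj A B ->
  exists x y, [/\ x \in A, y \notin A, x \notin B, y \in B & B = swap A x y].
Proof.
move=> cAB; rewrite /sadj cardsU.
have -> : (A :\: B) :&: (B :\: A) = set0.
  by apply/setP => z; rewrite !inE; case: (z \in A); rewrite /= ?andbF.
rewrite cards0 subn0.
have eqD : #|A :\: B| = #|B :\: A| by rewrite !cardsD cAB setIC.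
rewrite eqD addnn => cD.
have {}cD : #|B :\: A| = 1 by move: cD; case: #|_| => [|[|k]].
have /cards1P[x Ax] : #|A :\: B| == 1 by rewrite eqD cD.
have /cards1P[y By] : #|B :\: A| == 1 by rewrite cD.
have : x \in A :\: B by rewrite Ax inE.
have : y \in B :\: A by rewrite By inE.
rewrite !inE => /andP[yA yB] /andP[xB xA].
exists x, y; split=> //; apply/setP => z; rewrite !inE.
move: (congr1 (fun S : {set E} => z \in S) Ax).
move: (congr1 (fun S : {set E} => z \in S) By).
by rewrite !inE; do 2 case: (z \in _) => //=; case: eqP => //=; case: eqP.
Qed.

Section Exchange.
Variable F : {set {set E}}.
Hypothesis exF : exchange F.

(** Induction on the size of A \ B: an exchange keeps the cardinality of A and brings A closer to B.
    If A \ B is empty, an element of B \ A could not be exchanged for anything. *)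
Lemma exch_card A B : A \in F -> B \in F -> #|A| = #|B|.
Proof.
have [n] := ubnP #|A :\: B|; elim: n A => // n IHn A leAB AF BF.
have [AB0|[x xAB]] := set_0Vmem (A :\: B).
  have sAB : A \subset B by rewrite -setD_eq0 AB0.
  have [BA0|[x xBA]] := set_0Vmem (B :\: A).
    by congr #|pred_of_set _|; apply/eqP; rewrite eqEsubset sAB -setD_eq0 BA0 /=.
  by have [y] := exF BF AF xBA; rewrite AB0 inE.
have [y yBA ABF] := exF AF BF xAB.
move: (xAB) (yBA); rewrite !inE => /andP[xB xA] /andP[yA yB].
rewrite -(card_swap xA yA); apply: IHn => //.
rewrite -ltnS; apply: leq_trans leAB; rewrite ltnS; apply: proper_card.
apply/properP; split; last by exists x; rewrite // !inE eqxx (negPf xB) /= orbF; apply: contraNneq yA => <-.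
apply/subsetP => z; rewrite !inE => /andP[zB /predU1P[zy|/andP[_ ->]]]; last by rewrite zB.
by rewrite zy yB in zB.
Qed.

Lemma sadjF A B : A \in F -> B \in F -> sadj A B ->
  exists x y, [/\ x \in A, y \notin A, x \notin B, y \in B & B = swap A x y].
Proof. by move=> AF BF; apply: sadjP; apply: exch_card. Qed.

Lemma sadj_out A B e : A \in F -> B \in F -> sadj A B -> e \in A -> e \notin B ->
  exists2 y, y \notin A & B = swap A e y.
Proof.
move=> AF BF /(sadjF AF BF)[x [y [xA yA xB yB ->]]] eA.
rewrite !inE negb_or negb_and negbK eA orbF => /andP[_ /eqP->].
by exists y.
Qed.

(* The exchange axiom applied to the pair (A, B) brings A closer to B while
   keeping e, until A and B are adjacent. *)
Lemma exch_in A B e : A \in F -> B \in F -> e \in A -> e \notin B ->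
  exists A', [/\ A' \in F, e \in A' & sadj A' B].
Proof.
have [n] := ubnP #|A :\: B|; elim: n A => // n IHn A leAB AF BF eA eB.
have [AB0|[x xAB]] := set_0Vmem ((A :\: B) :\ e).
  exists A; split=> //.
  have [y yBA ABF] : exists2 f, f \in B :\: A & f |: (A :\ e) \in F.
    by apply: exF => //; rewrite inE eB.
  move: yBA; rewrite !inE => /andP[yA yB].
  suff -> : B = swap A e y by apply: sadj_swap.
  apply/esym/eqP; rewrite eqEcard (exch_card BF ABF) leqnn andbT.
  apply/subsetP => z; rewrite !inE => /predU1P[->//|/andP[ze zA]].
  by move: (in_set0 z); rewrite -AB0 !inE ze zA andbT /= => /negbFE.
move: xAB; rewrite !inE => /and3P[xe xB xA].
have [y yBA ABF] : exists2 f, f \in B :\: A & f |: (A :\ x) \in F.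
  by apply: exF => //; rewrite inE xB.
move: (yBA); rewrite !inE => /andP[yA yB].
apply: (IHn _ _ ABF BF) => //; last by rewrite !inE (eq_sym e x) xe eA orbT.
rewrite -ltnS; apply: leq_trans leAB; rewrite ltnS; apply: proper_card.
apply/properP; split; last by exists x; rewrite !inE xB ?xA // eqxx /= orbF; apply: contraNneq yA => <-.
apply/subsetP => z; rewrite !inE => /andP[zB /predU1P[zy|/andP[_ ->]]]; last by rewrite zB.
by rewrite zy yB in zB.
Qed.

Lemma exch_fcon e : exchange (fcon F e).
Proof.
move=> A B; rewrite !inE => /andP[AF eA] /andP[BF eB] x xAB.
have [y yBA ABF] := exF AF BF xAB; exists y => //; rewrite inE ABF /=.
move: xAB; rewrite !inE => /andP[xB _].
by apply/orP; right; rewrite eA andbT; apply: contraNneq xB => <-.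
Qed.

Lemma exch_fdel e : exchange (fdel F e).
Proof.
move=> A B; rewrite !inE => /andP[AF eA] /andP[BF eB] x xAB.
have [y yBA ABF] := exF AF BF xAB; exists y => //; rewrite inE ABF /=.
move: yBA; rewrite !inE => /andP[_ yB].
by rewrite (negPf eA) andbF orbF; apply: contraNneq eB => ->.
Qed.

Lemma free_swap A x : A \in F -> x \in A -> x \in free F ->
  exists2 y, y \notin A & swap A x y \in F.
Proof.
move=> AF xA /freeP[B BF xB].
have [y] : exists2 f, f \in B :\: A & f |: (A :\ x) \in F.
  by apply: exF => //; rewrite inE xB.
by rewrite !inE => /andP[yA _]; exists y.
Qed.

Lemma free_fcon A e x : A \in fcon F e -> x \in A -> x != e -> x \in free F ->
  x \in free (fcon F e).
Proof.
rewrite inE => /andP[AF eA] xA xe /(free_swap AF xA)[y yA SF].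
apply/freeP; exists (swap A x y).
  by rewrite inE SF !inE eA (eq_sym e x) xe orbT.
by rewrite !inE eqxx /= orbF; apply: contraNneq yA => <-.
Qed.

(** Among the elements of A only [e] can stop being free: exchanging another one leaves [e] in
    place. *)
Lemma rank_fcon A e : A \in fcon F e ->
  #|A :&: free F| <= #|A :&: free (fcon F e)|.+1.
Proof.
move=> AFe; apply: leq_trans (_ : #|e |: (A :&: free (fcon F e))| <= _).
  apply: subset_leq_card; apply/subsetP => x /setIP[xA xF].
  rewrite in_setU1 in_setI; case: eqVneq => //= xe.
  by rewrite xA (free_fcon AFe xA xe xF).
by rewrite cardsU1 -add1n leq_add2r leq_b1.
Qed.

(** Elements outside [free F] lie in every member, so members of equal size also have equally many
    free elements. *)
Lemma rank_const A B : A \in F -> B \in F -> #|A :&: free F| = #|B :&: free F|.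
Proof.
move=> AF BF; have := exch_card AF BF.
rewrite -(cardsID (free F) A) -(cardsID (free F) B).
suff core C : C \in F -> C :\: free F = ~: free F.
  by rewrite !core //; exact: addIn.
move=> CF; apply/setP => x; rewrite in_setD in_setC.
case: (boolP (x \in free F)) => //= /freeP nx.
by apply/negPn/negP => xC; apply: nx; exists C.
Qed.

(** Different pairs (x, y) give different sets [swap A x y]; A itself is one more member, whence the
    strict inequality. *)
Lemma rank_lt_card A k : A \in F ->
  (forall x, x \in A :&: free F -> k <= #|[set y | y \notin A & swap A x y \in F]|) ->
  k * #|A :&: free F| < #|F|.
Proof.
move=> AF kA; pose P : pred (E * E) := fun p =>
  [&& p.1 \in A, p.2 \notin A & swap A p.1 p.2 \in F].
have inj : {in [set p | P p] &, injective (fun p => swap A p.1 p.2)}.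
  move=> [x y] [x' y']; rewrite !inE /P /= => /and3P[xA yA _] /and3P[x'A y'A _] eqS.
  have : x \notin swap A x y by rewrite !inE eqxx /= orbF; apply: contraNneq yA => <-.
  rewrite eqS !inE xA andbT negb_or negbK => /andP[_ /eqP xx'].
  have : y \in swap A x y by rewrite !inE eqxx.
  by rewrite eqS !inE (negPf yA) andbF orbF => /eqP->; rewrite xx'.
rewrite (cardsD1 A F) AF add1n ltnS.
apply: leq_trans (_ : #|[set swap A p.1 p.2 | p in [set p | P p]]| <= _); last first.
  apply: subset_leq_card; apply/subsetP => B /imsetP[[x y]].
  rewrite inE => /and3P[/= xA yA BF ->]; rewrite !inE BF andbT.
  apply/negP => /eqP/setP/(_ y); rewrite !inE eqxx /= => /esym.
  by rewrite (negPf yA).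
rewrite (card_in_imset inj) -[leqRHS]sum1_card (eq_bigl P); last by move=> p; rewrite inE.
rewrite -(pair_big_dep (mem A) (fun x y => (y \notin A) && (swap A x y \in F)) (fun _ _ => 1)) /=.
rewrite mulnC -sum_nat_const.
apply: leq_trans (_ : \sum_(i in A :&: free F) #|[set y | y \notin A & swap A i y \in F]| <= _).
  exact: leq_sum.
rewrite [leqRHS](bigID (mem (free F))) /=.
apply: leq_trans (leq_addr _ _).
rewrite (eq_bigl (fun i => (i \in A) && (i \in free F))); last by move=> x; rewrite inE.
by apply: leq_sum => x _; rewrite -sum1_card; apply/eq_leq/eq_bigl => y; rewrite inE.
Qed.

Lemma free_swap_card A x : A \in F -> x \in A :&: free F ->
  0 < #|[set y | y \notin A & swap A x y \in F]|.
Proof.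
move=> AF /setIP[xA xF]; have [y yA SF] := free_swap AF xA xF.
by apply/card_gt0P; exists y; rewrite inE yA.
Qed.

Lemma common_free X Y : X \in F -> Y \in F -> sadj X Y -> 1 < #|X :&: free F| ->
  exists e, [/\ X \in fcon F e, Y \in fcon F e & e \in free F].
Proof.
move=> XF YF /(sadjF XF YF)[x [y [xX yX xY yY eY]]].
rewrite (cardsD1 x) => gt1.
have /card_gt0P[e] : 0 < #|(X :&: free F) :\ x|.
  by move: gt1; case: (x \in _); rewrite ?add1n ?add0n // => /ltnW.
rewrite in_setD1 in_setI => /and3P[ex eX eF].
exists e; split=> //; rewrite inE ?XF ?YF ?eX //.
by rewrite eY !inE eX ex orbT.
Qed.

(* For U, V, e as below, the only neighbour Z of U avoiding e for which there
   might be no V' is (U :|: V) :\ e. *)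
Lemma square U V Z e : U \in fcon F e -> V \in fcon F e -> sadj U V ->
  Z \in fdel F e -> sadj U Z -> Z != (U :|: V) :\ e ->
  exists V', [/\ V' \in fdel F e, sadj Z V' & sadj V V'].
Proof.
rewrite !inE => /andP[UF eU] /andP[VF eV] UV /andP[ZF eZ] UZ nZ.
have [a [b [aU bU aV bV VE]]] := sadjF UF VF UV.
have [f fU ZE] := sadj_out UF ZF UZ eU eZ.
have ea : e != a by apply: contraNneq aV => <-.
have eb : e != b by apply: contraNneq bU => <-.
have ef : e != f by apply: contraNneq fU => <-.
have ab : a != b by apply: contraNneq bU => <-.
have af : a != f by apply: contraNneq fU => <-.
(* If f = b, then Z would be the excluded set. *)
have fb : f != b.
  apply: contraNneq nZ => fb; apply/eqP; rewrite ZE fb VE; apply/setP => z.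
  rewrite !inE; case: (eqVneq z e) => [->|_] /=; first by rewrite (negPf eb).
  by case: (z == b) => //=; case: (z == a); case: (z \in U).
have [y yZV V'F] : exists2 y, y \in Z :\: V & y |: (V :\ e) \in F.
  by apply: exF => //; rewrite inE eZ.
move: yZV; rewrite inE => /andP[yV yZ].
have ye : e != y by apply: contraNneq eZ => ->.
exists (swap V e y); rewrite !inE V'F eqxx (negPf ye); split=> //; last exact: sadj_swap.
rewrite VE in yV; move: yV; rewrite !inE negb_or negb_and negbK => /andP[yb yaU].
(* As Z = U - e + f and V = U - a + b, no elements besides a and f lie in Z \ V; with either, V' is
   one exchange away from Z. *)
have {yZ yaU} [ya|yf] : y = a \/ y = f.
  move: yZ; rewrite ZE !inE => /predU1P[->|/andP[_ yU]]; first by right.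
  by move: yaU; rewrite yU orbF => /eqP->; left.
  have -> : swap V e y = swap Z f b.
    rewrite ya ZE VE; apply/setP => z; rewrite !inE.
    case: (eqVneq z a) => [->|za] /=; first by rewrite af aU (eq_sym a e) ea !orbT.
    case: (eqVneq z b) => [->|zb] /=; first by rewrite (eq_sym b e) eb ?orbT.
    by case: (eqVneq z f) => [->|zf] //=; rewrite (negPf fU) andbF.
  apply: sadj_swap; rewrite ZE !inE ?eqxx // negb_or (eq_sym b f) fb.
  by rewrite (negPf bU) andbF.
have -> : swap V e y = swap Z a b.
  rewrite yf ZE VE; apply/setP => z; rewrite !inE.
  case: (eqVneq z f) => [->|zf] /=; first by rewrite (eq_sym f a) af orbT.
  case: (eqVneq z b) => [->|zb] /=; first by rewrite (eq_sym b e) eb ?orbT.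
  by rewrite andbCA.
apply: sadj_swap; rewrite ZE !inE; first by rewrite aU (eq_sym a e) ea orbT.
by rewrite negb_or (eq_sym b f) fb (negPf bU) andbF.
Qed.

End Exchange.
End Families.

(** * Hamiltonian paths in basis graphs *)

Section HamiltonianPaths.
Variable E : finType.
Implicit Types (F : {set {set E}}) (A B U V W X Y Z : {set E}).
Implicit Types (s q Q : seq {set E}).

(* The path is X :: s. *)
Definition hpath F X Y s :=
  [&& path (@sadj E) X s, uniq (X :: s), last X s == Y & [set A in X :: s] == F].

Lemma hpath_mem F X Y s : hpath F X Y s -> X :: s =i F.
Proof. by case/and4P=> _ _ _ /eqP<- A; rewrite [RHS]inE. Qed.

Lemma hpath_size F X Y s : hpath F X Y s -> size (X :: s) = #|F|.
Proof.
move=> hp; have /and4P[_ us _ _] := hp.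
by rewrite -(card_uniqP us); exact: (eq_card (hpath_mem hp)).
Qed.

(** The path is X :: s, so inserting before position i of s cuts the edge from [nth X (X :: s) i] to
    [nth X s i]. *)
Definition insert_at i Q s := take i s ++ Q ++ drop i s.

Lemma hpath_insert F e X Y s i Q : hpath (fcon F e) X Y s -> i < size s ->
  path (@sadj E) (nth X (X :: s) i) (rcons Q (nth X s i)) ->
  uniq Q -> Q =i fdel F e -> hpath F X Y (insert_at i Q s).
Proof.
move=> hp lt_i pQ uQ mQ; have mem_s := hpath_mem hp.
have lastU : last X (take i s) = nth X (X :: s) i.
  rewrite (last_nth X) size_takel ?(ltnW lt_i) //.
  by rewrite (_ : X :: take i s = take i.+1 (X :: s)) // nth_take.
have defs : s = take i s ++ nth X s i :: drop i.+1 s.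
  by rewrite -drop_nth // cat_take_drop.
have perm_s : perm_eq (X :: insert_at i Q s) (Q ++ X :: s).
  by rewrite /insert_at -cat_cons perm_catCA /= cat_take_drop.
have /and4P[ps us ls _] := hp.
move: ps ls; rewrite {1 2}defs => ps ls; apply/and4P; split.
- rewrite /insert_at (drop_nth X lt_i) -cat_rcons cat_path lastU.
  move: ps; rewrite cat_path lastU /= => /and3P[-> _ pv] /=.
  by rewrite cat_path pQ last_rcons.
- rewrite (perm_uniq perm_s) cat_uniq uQ us andbT.
  apply/hasPn => A; rewrite mem_s mQ !inE => /andP[_ eA].
  by rewrite eA andbF.
- by move: ls; rewrite /insert_at (drop_nth X lt_i) !last_cat.
- apply/eqP/setP => A; rewrite inE (perm_mem perm_s) mem_cat mem_s mQ !inE.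
  by rewrite -andb_orr orNb andbT.
Qed.

(** Together with the next two lemmas this recovers s, Q and i from the result, so that insertion is
    injective; i is the position of the first set avoiding [e]. *)
Lemma filter_insert_in F e X Y s i Q : hpath (fcon F e) X Y s -> Q =i fdel F e ->
  [seq A : {set E} <- insert_at i Q s | e \in A] = s.
Proof.
move=> hp mQ; rewrite !filter_cat (_ : [seq A : {set E} <- Q | e \in A] = [::]).
  rewrite -filter_cat cat_take_drop; apply/all_filterP/allP => A As.
  have : A \in X :: s by rewrite inE As orbT.
  by rewrite (hpath_mem hp) inE => /andP[].
apply/eqP; rewrite -(negbK (_ == _)) -has_filter; apply/hasPn => A.
by rewrite mQ inE => /andP[].
Qed.

Lemma filter_insert_out F e X Y s i Q : hpath (fcon F e) X Y s -> Q =i fdel F e ->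
  [seq A : {set E} <- insert_at i Q s | e \notin A] = Q.
Proof.
move=> hp mQ; have es A : A \in s -> e \in A.
  move=> As; have : A \in X :: s by rewrite inE As orbT.
  by rewrite (hpath_mem hp) inE => /andP[].
have nil t : {subset t <= s} -> [seq A : {set E} <- t | e \notin A] = [::].
  move=> ts; apply/eqP; rewrite -(negbK (_ == _)) -has_filter; apply/hasPn => A.
  by move/ts/es => ->.
rewrite !filter_cat (nil (take i s)); last by move=> A /mem_take.
rewrite (nil (drop i s)) ?cats0 /=; last by move=> A /mem_drop.
by apply/all_filterP/allP => A; rewrite mQ inE => /andP[].
Qed.

Lemma find_insert F e X Y s i Q : hpath (fcon F e) X Y s -> Q =i fdel F e ->
  i < size s -> fdel F e != set0 ->
  find (fun A => e \notin A) (insert_at i Q s) = i.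
Proof.
move=> hp mQ lt_i nz; have es A : A \in s -> e \in A.
  move=> As; have : A \in X :: s by rewrite inE As orbT.
  by rewrite (hpath_mem hp) inE => /andP[].
rewrite find_cat (_ : has _ _ = false); last first.
  by apply/hasPn => A /mem_take/es ->.
rewrite size_takel ?(ltnW lt_i) //; case: Q mQ => [|A Q] mQ.
  by case/set0Pn: nz => A; rewrite -mQ.
rewrite /= (_ : e \notin A) ?addn0 //.
by have := mQ A; rewrite !inE eqxx => /esym/andP[].
Qed.

(** A list without repetitions stands for a set of paths, the type of all sequences being
    infinite. *)
Definition many_hpaths F X Y k :=
  exists L, [/\ uniq L, {in L, forall s, hpath F X Y s} & k <= size L].

Lemma leq_sumn_map (T : eqType) (f : T -> nat) l (s : seq T) :
  {in s, forall x, l <= f x} -> size s * l <= sumn (map f s).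
Proof.
elim: s => //= x s IHs lf; rewrite mulSn leq_add ?lf ?mem_head //.
by apply: IHs => y ys; apply: lf; rewrite inE ys orbT.
Qed.

(** The factors count the path of [fcon F e], the edge where it is cut and the inserted path; m is
    below the number of vertices of the first path, hence at most its number of edges. *)
Lemma many_hpaths_mul F e X Y k m l : fdel F e != set0 ->
  many_hpaths (fcon F e) X Y k -> m < #|fcon F e| ->
  (forall U V, U \in fcon F e -> V \in fcon F e -> sadj U V ->
    exists U' V', [/\ sadj U U', sadj V V' & many_hpaths (fdel F e) U' V' l]) ->
  many_hpaths F X Y (k * m * l).
Proof.
move=> nz [L1 [uL1 hL1 kL1]] ltm sq.
pose P (p : {set E} * {set E}) (L : seq (seq {set E})) :=
  p.1 \in fcon F e -> p.2 \in fcon F e -> sadj p.1 p.2 ->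
  [/\ uniq L, l <= size L & forall Q, Q \in L ->
    [/\ path (@sadj E) p.1 (rcons Q p.2), uniq Q & Q =i fdel F e]].
have /choice[LQ LQP] : forall p, exists L, P p L.
  case=> U V; have [/and3P[UF VF UV]|nUV] := boolP [&& U \in fcon F e, V \in fcon F e & sadj U V]; last first.
    (* Pairs that are not adjacent members of [fcon F e] receive an arbitrary list. *)
    by exists [::] => UF VF UV; case/negP: nUV; rewrite UF VF.
  have [U' [V' [UU VV [L [uL hL lL]]]]] := sq _ _ UF VF UV.
  (* The sequence of an [hpath] omits its first vertex, which has to be restored in the insert. *)
  exists (map (cons U') L) => _ _ _; split; last 1 first.
  - move=> Q /mapP[q /hL hq ->]; have /and4P[pq uq /eqP lq _] := hq.
    by split=> //=; [rewrite UU rcons_path pq lq sadj_sym | apply: hpath_mem hq].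
  - by rewrite map_inj_uniq // => q q' [].
  - by rewrite size_map.
pose ps := [seq (s, i) | s <- L1, i <- iota 0 m].
pose g (p : seq {set E} * nat) := LQ (nth X (X :: p.1) p.2, nth X p.1 p.2).
have psP p : p \in ps -> [/\ hpath (fcon F e) X Y p.1, p.2 < size p.1, uniq (g p),
    l <= size (g p) & forall Q, Q \in g p ->
     [/\ path (@sadj E) (nth X (X :: p.1) p.2) (rcons Q (nth X p.1 p.2)),
         uniq Q & Q =i fdel F e]].
  case/allpairsP=> [[s i] [/= /hL1 hs]]; rewrite mem_iota add0n => /= lt_im ->.
  have lt_is : i < size s.
    by apply: leq_trans lt_im _; rewrite -ltnS -[(size s).+1]/(size (X :: s)) (hpath_size hs).
  have mem_s := hpath_mem hs.
  have [] := LQP (nth X (X :: s) i, nth X s i).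
  - by rewrite /= -mem_s mem_nth //= ltnW.
  - by rewrite /= -mem_s inE mem_nth ?orbT.
  - by have /and4P[/(pathP X)/(_ _ lt_is)] := hs.
  by move=> uL lL hL; split.
exists [seq insert_at p.2 Q p.1 | p <- ps, Q <- g p]; split.
- apply: allpairs_uniq_dep.
  + by apply: allpairs_uniq => //; [exact: iota_uniq | move=> [? ?] [? ?]].
  + by move=> p /psP[].
  + move=> u v /allpairsPdep[p [Q [pps Qg ->]]].
    move=> /allpairsPdep[p' [Q' [pps' Qg' ->]]] /= eqI.
    have [hp lt_p _ _ /(_ _ Qg)[_ _ mQ]] := psP _ pps.
    have [hp' lt_p' _ _ /(_ _ Qg')[_ _ mQ']] := psP _ pps'.
    have eq1 : p = p'.
      rewrite [p]surjective_pairing [p']surjective_pairing; congr (_, _).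
        by rewrite -(filter_insert_in p.2 hp mQ) eqI (filter_insert_in _ hp' mQ').
      by rewrite -(find_insert hp mQ lt_p nz) eqI (find_insert hp' mQ' lt_p' nz).
    by rewrite -(filter_insert_out p.2 hp mQ) eqI (filter_insert_out _ hp' mQ') eq1.
- move=> _ /allpairsPdep[p [Q [/psP[hp lt_p _ _ gP] /gP[pQ uQ mQ] ->]]].
  exact: (hpath_insert hp lt_p pQ uQ mQ).
rewrite size_allpairs_dep.
apply: leq_trans (_ : size ps * l <= _).
  by rewrite leq_mul // size_allpairs size_iota leq_mul.
by apply: leq_sumn_map => p /psP[].
Qed.

Section Exchange.
Variable F : {set {set E}}.
Hypothesis exF : exchange F.

Lemma square_ex U V Z e : U \in fcon F e -> V \in fcon F e -> sadj U V ->
  Z \in fdel F e -> sadj U Z || sadj V Z -> Z != (U :|: V) :\ e ->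
  exists U' V', [/\ sadj U U', sadj V V', U' \in fdel F e, V' \in fdel F e & sadj U' V'].
Proof.
move=> UF VF UV ZF /orP[UZ|VZ] nZ.
  have [V' [V'F ZV' VV']] := square exF UF VF UV ZF UZ nZ.
  by exists Z, V'.
rewrite setUC in nZ; rewrite sadj_sym in UV.
have [U' [U'F ZU' UU']] := square exF VF UF UV ZF VZ nZ.
by exists U', Z; rewrite (sadj_sym U').
Qed.

(** Members agree outside [free F], so two distinct ones of rank at most 1 have one free element
    each, and differ by exchanging these. *)
Lemma complete_small A B : A \in F -> B \in F -> A != B -> #|A :&: free F| <= 1 ->
  sadj A B.
Proof.
move=> AF BF neqAB leA; have leB : #|B :&: free F| <= 1.
  by rewrite (rank_const exF BF AF).
have coreF C z : C \in F -> z \notin free F -> z \in C.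
  by move=> CF zf; apply/negPn/negP => zC; case/freeP: zf; exists C.
have [x xA xB] : exists2 x, x \in A & x \notin B.
  apply/subsetPn; apply/negP => sAB; case/negP: neqAB.
  by rewrite eqEcard sAB (exch_card exF BF AF) leqnn.
have [y yB yA] : exists2 y, y \in B & y \notin A.
  apply/subsetPn; apply/negP => sBA; case/negP: neqAB.
  by rewrite eq_sym eqEcard sBA (exch_card exF AF BF) leqnn.
have xF : x \in free F by apply/freeP; exists B.
have yF : y \in free F by apply/freeP; exists A.
suff -> : B = swap A x y by apply: sadj_swap.
apply/setP => z; rewrite in_setU1 in_setD1.
have [zF|zF] := boolP (z \in free F); last first.
  by rewrite (coreF B z BF zF) (coreF A z AF zF) andbT (_ : z != x) ?orbT //; apply: contraNneq zF => ->.
have inA : z \in A -> z = x.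
  by move=> zA; move/card_le1_eqP: leA; apply; rewrite in_setI ?zA ?xA.
have inB : z \in B -> z = y.
  by move=> zB; move/card_le1_eqP: leB; apply; rewrite in_setI ?zB ?yB.
case: (eqVneq z y) => [->//|zy] /=.
apply/idP/idP => [/inB/eqP|/andP[zx /inA/eqP]]; last by rewrite (negPf zx).
by rewrite (negPf zy).
Qed.

End Exchange.

(** Strong induction on the size of F. The path of [fcon F e] is cut at an edge carrying a square,
    or at its first edge if [fdel F e] is a single set; one of the two always applies. *)
Lemma hpath_exists F X Y : exchange F -> X \in F -> Y \in F -> sadj X Y ->
  exists s, hpath F X Y s.
Proof.
have [n] := ubnP #|F|; elim: n F X Y => // n IHn F X Y ltF exF XF YF XY.
have neqXY : X != Y by apply: contraTneq XY => ->; rewrite sadj_irr.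
have [small|/(common_free exF XF YF XY)[e [Xe Ye eF]]] := leqP #|X :&: free F| 1.
  (* In rank at most 1 the basis graph is complete, so any ordering from X to Y will do. *)
  pose t := enum ((F :\ X) :\ Y); exists (rcons t Y).
  have ut : uniq (X :: rcons t Y).
    rewrite -rcons_cons rcons_uniq /= enum_uniq !(inE, mem_enum) eqxx /=.
    by rewrite eqxx andbF orbF eq_sym neqXY.
  have mt : X :: rcons t Y =i F.
    move=> A; rewrite inE mem_rcons inE mem_enum !inE.
    by case: (eqVneq A X) => [->//|_]; case: (eqVneq A Y) => [->|].
  apply/and4P; split=> //; last 2 first.
  - by rewrite last_rcons.
  - by apply/eqP/setP => A; rewrite inE mt.
  rewrite -[path _ _ _]/(sorted (@sadj E) (X :: rcons t Y)); apply: pairwise_sorted.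
  move: ut; rewrite uniq_pairwise; apply: (@sub_in_pairwise _ (mem F)).
    move=> A B AF BF /= neqAB; apply: (complete_small exF AF BF neqAB).
    by rewrite (rank_const exF AF XF).
  by apply/allP => A; rewrite mt.
have /freeP[Z0 Z0F eZ0] := eF.
have ltcon : #|fcon F e| < n.
  rewrite -ltnS; apply: leq_trans ltF; rewrite ltnS; apply: proper_card.
  apply/properP; split; first exact: fcon_sub.
  by exists Z0; rewrite // inE (negPf eZ0) andbF.
have ltdel : #|fdel F e| < n.
  rewrite -ltnS; apply: leq_trans ltF; rewrite ltnS; apply: proper_card.
  apply/properP; split; first exact: fdel_sub.
  by exists X; rewrite // inE; move: Xe; rewrite inE => /andP[_ ->]; rewrite andbF.
have [s hs] := IHn _ _ _ ltcon (@exch_fcon _ _ exF e) Xe Ye XY.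
have ms := hpath_mem hs; have /and4P[/(pathP X) ps _ /eqP ls _] := hs.
have s_gt0 : 0 < size s by case: (s) ls neqXY => //= ->; rewrite eqxx.
suff [i [Q [lt_i pQ uQ mQ]]] : exists i Q, [/\ i < size s,
    path (@sadj E) (nth X (X :: s) i) (rcons Q (nth X s i)), uniq Q & Q =i fdel F e].
  by exists (insert_at i Q s); exact: (hpath_insert hs lt_i pQ uQ mQ).
have inU i : i <= size s -> nth X (X :: s) i \in fcon F e by rewrite -ms => ?; exact: mem_nth.
have inV i : i < size s -> nth X s i \in fcon F e by exact: (inU i.+1).
have nbr W : W \in fcon F e -> exists2 Z, Z \in fdel F e & sadj W Z.
  rewrite inE => /andP[WF eW]; have [y yW SF] := free_swap exF WF eW eF.
  exists (swap W e y); last exact: sadj_swap.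
  by rewrite inE SF !inE eqxx orbF; apply: contraNneq yW => <-.
have [one|gt1] := leqP #|fdel F e| 1.
  have eqZ Z : Z \in fdel F e -> Z = Z0.
    by move=> ZF; apply: (card_le1_eqP one) => //; rewrite inE Z0F.
  have adjZ W : W \in fcon F e -> sadj W Z0 by case/nbr => Z /eqZ ->.
  exists 0, [:: Z0]; split=> //=.
    by rewrite adjZ // sadj_sym adjZ // inV.
  by move=> Z; rewrite inE; apply/eqP/idP => [->|/eqZ//]; rewrite inE Z0F.
have [[i [lt_i [U' [V' [UU VV U'F V'F UV']]]]]|nogood] := pselect (exists i, i < size s /\
    exists U' V', [/\ sadj (nth X (X :: s) i) U', sadj (nth X s i) V',
      U' \in fdel F e, V' \in fdel F e & sadj U' V']).
  have [q hq] := IHn _ _ _ ltdel (@exch_fdel _ _ exF e) U'F V'F UV'.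
  have /and4P[pq uq /eqP lq _] := hq.
  exists i, (U' :: q); split=> //; last exact: hpath_mem hq.
  by rewrite /= UU rcons_path pq lq sadj_sym.
(* Without a square at edge i, its ends can have no neighbour in [fdel F e] other than D i. *)
pose D i := (nth X (X :: s) i :|: nth X s i) :\ e.
have bad i Z : i < size s -> Z \in fdel F e ->
    sadj (nth X (X :: s) i) Z || sadj (nth X s i) Z -> Z = D i.
  move=> lt_i ZF adjZ; apply/eqP/negPn/negP => nZ; apply: nogood; exists i; split=> //.
  apply: (square_ex exF) adjZ nZ => //; [exact/inU/ltnW | exact: inV | exact: ps].
(* Every vertex has a neighbour avoiding [e], so the sets D i of consecutive edges coincide through
   their common vertex. *)
have allD i Z : i <= size s -> Z \in fdel F e -> sadj (nth X (X :: s) i) Z -> Z = D 0.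
  elim: i Z => [|i IHi] Z le_i ZF adjZ; first by apply: bad; rewrite ?adjZ.
  rewrite [LHS](bad i) // ?[sadj (nth X s i) Z]adjZ ?orbT //.
  have [Z' Z'F adjZ'] := nbr _ (inU i (ltnW le_i)).
  by rewrite -(bad i Z') ?adjZ' //; apply: IHi => //; apply: ltnW.
(* Each member of [fdel F e] is a neighbour of some vertex of the path. *)
have eqD Z : Z \in fdel F e -> Z = D 0.
  move=> ZF; move: (ZF) (Xe); rewrite inE => /andP[ZF' eZ]; rewrite inE => /andP[_ eX].
  have [W [WF eW WZ]] := exch_in exF XF ZF' eX eZ.
  have : W \in X :: s by rewrite ms inE WF.
  move=> /(nthP X)[i lt_i eW']; apply: (allD i) => //.
  by rewrite eW'.
have /card_gt1P[Z1 [Z2 [/eqD-> /eqD->]]] := gt1.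
by rewrite eqxx.
Qed.
End HamiltonianPaths.

(** * Lower bounds on the number of Hamiltonian paths *)

Section Counting.
Variable E : finType.
Implicit Types (F : {set {set E}}) (A B U V W X Y Z : {set E}).

(* U, V, Z then extend to a 4-cycle U, U', V', V of the basis graph with
   U', V' in [fdel F e]: see [square_ex]. *)
Definition squares F := forall U V e, U \in F -> V \in F -> sadj U V ->
  e \in U -> e \in V -> e \in free F ->
  exists Z, [/\ Z \in fdel F e, sadj U Z || sadj V Z & Z != (U :|: V) :\ e].

(* x itself is not counted: the fundamental cocircuits have at least 3 elements. *)
Definition cosimple F := forall A x, A \in F -> x \in A :&: free F ->
  1 < #|[set y | y \notin A & swap A x y \in F]|.

(* Contracting U minus g and a would make any two of g, a, b, e a basis. *)
Definition noU24 F := forall U g a b e, g \in U -> a \in U -> g != a ->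
  b \notin U -> e \notin U -> b != e ->
  U \in F -> swap U a b \in F -> swap U g b \in F -> swap U a e \in F ->
  swap U g e \in F -> swap (swap U a b) g e \in F -> False.

Lemma fdel_neq0 F e : e \in free F -> fdel F e != set0.
Proof. by case/freeP=> A AF eA; apply/set0Pn; exists A; rewrite inE AF. Qed.

Lemma many_hpaths1 F X Y : exchange F -> X \in F -> Y \in F -> sadj X Y ->
  many_hpaths F X Y 1.
Proof.
move=> exF XF YF XY; have [s hs] := hpath_exists exF XF YF XY.
by exists [:: s]; split=> // t; rewrite inE => /eqP->.
Qed.

Lemma many_hpathsW F X Y k l : l <= k -> many_hpaths F X Y k -> many_hpaths F X Y l.
Proof. by move=> lk [L [uL hL kL]]; exists L; split=> //; apply: leq_trans kL. Qed.

(** The set Z found for F arises from U or V by exchanging out [e], which differs from c, so it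
    still contains c. *)
Lemma squares_fcon F c : exchange F -> squares F -> squares (fcon F c).
Proof.
move=> exF sqF U V e Uc Vc UV eU eV efc.
have ef : e \in free F by apply: (subsetP (free_sub (fcon_sub F c))).
have ec : e != c.
  by apply: contraTneq efc => ->; apply/freeP => -[A]; rewrite inE => /andP[_ ->].
move: (Uc) (Vc); rewrite !inE => /andP[UF cU] /andP[VF cV].
have [Z [ZF adjZ nZ]] := sqF U V e UF VF UV eU eV ef.
exists Z; split=> //; move: ZF; rewrite !inE => /andP[ZF eZ].
rewrite ZF eZ andbT /=; case/orP: adjZ => adjZ.
  have [y _ ->] := sadj_out exF UF ZF adjZ eU eZ.
  by rewrite !inE cU eq_sym andbT [c == e]eq_sym (negPf ec) orbT.
have [y _ ->] := sadj_out exF VF ZF adjZ eV eZ.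
by rewrite !inE cV andbT [c == e]eq_sym (negPf ec) orbT.
Qed.

(** For r at least 2, contraction leaves rank at least r - 1, so the path has at least r - 1 edges;
    each carries a square and admits an insert. *)
Lemma squares_many r F X Y : exchange F -> squares F -> X \in F -> Y \in F ->
  sadj X Y -> r <= #|X :&: free F| -> many_hpaths F X Y (r.-1)`!.
Proof.
elim: r F => [|[|r] IHr] F exF sqF XF YF XY le_r; try exact: many_hpaths1.
have [|e [Xe Ye eF]] := common_free exF XF YF XY; first exact: leq_trans le_r.
have le_re : r.+1 <= #|X :&: free (fcon F e)|.
  by rewrite -ltnS (leq_trans le_r) // rank_fcon.
have exFe := exch_fcon exF (e := e).
rewrite /= factS mulnC -[_ * _]muln1; apply: (many_hpaths_mul (fdel_neq0 eF)).
- by apply: IHr => //; apply: squares_fcon.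
- apply: leq_ltn_trans le_re _; rewrite -[ltnLHS]mul1n.
  by apply: (rank_lt_card Xe) => x; apply: (free_swap_card exFe Xe).
move=> U V Ue Ve UV; move: (Ue) (Ve); rewrite !inE => /andP[UF eU] /andP[VF eV].
have [Z [ZF adjZ nZ]] := sqF U V e UF VF UV eU eV eF.
have [U' [V' [UU VV U'F V'F UV']]] := square_ex exF Ue Ve UV ZF adjZ nZ.
by exists U', V'; split=> //; apply: many_hpaths1 => //; apply: exch_fdel.
Qed.

Lemma cosimple_other F A x z : cosimple F -> A \in F -> x \in A :&: free F ->
  exists y, [/\ y \notin A, swap A x y \in F & y != z].
Proof.
move=> csF AF xA; have /card_gt1P[y1 [y2 []]] := csF A x AF xA.
rewrite !inE => /andP[y1A y1F] /andP[y2A y2F] y12.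
case: (eqVneq y1 z) => [y1z|]; last by exists y1.
by exists y2; split=> //; rewrite eq_sym -y1z.
Qed.

Lemma swap_neq A x y z : y != z -> y \notin A -> swap A x y != swap A x z.
Proof.
move=> yz yA; apply/eqP => /setP/(_ y); rewrite !inE eqxx (negPf yz) /=.
by rewrite (negPf yA) andbF.
Qed.

(** Rewrites the set excluded in [square] as the exchange of [e] for b. *)
Lemma setU_swap U a b e : a \in U -> e \in U -> e != b ->
  (U :|: swap U a b) :\ e = swap U e b.
Proof.
move=> aU eU eb; apply/setP => z; rewrite !inE.
case: (eqVneq z e) => [->|_]; first by rewrite (negPf eb).
by case: (eqVneq z a) => [->|_]; case: (z == b); rewrite ?aU //= ?orbT ?orbb.
Qed.

Lemma cosimple_fcon F c : cosimple F -> cosimple (fcon F c).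
Proof.
move=> csF A x; rewrite inE => /andP[AF cA] /setIP[xA xfc].
have xf : x \in free F by apply: (subsetP (free_sub (fcon_sub F c))).
have xc : x != c.
  by apply: contraTneq xfc => ->; apply/freeP => -[B]; rewrite inE => /andP[_ ->].
have := csF A x AF; rewrite in_setI xA xf => /(_ isT)/leq_trans; apply.
apply/subset_leq_card/subsetP => y; rewrite !inE => /andP[-> ->].
by rewrite cA [c == x]eq_sym xc orbT.
Qed.

Lemma noU24_sub F F' : F' \subset F -> noU24 F -> noU24 F'.
Proof.
move=> /subsetP sF noF U g a b e gU aU ga bU eU be *.
by apply: (noF U g a b e) => //; apply: sF.
Qed.

(** If there is no square, exchanging g out of U or V can only give the excluded set or bring in
    [e]; cosimplicity makes both occur. *)
Lemma cosimple_squares F e : exchange F -> cosimple F -> noU24 F ->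
  squares (fdel F e).
Proof.
move=> exF csF noF U V g UF VF UV gU gV gfd.
have exFd := exch_fdel exF (e := e).
have gf : g \in free F by apply: (subsetP (free_sub (fdel_sub F e))).
have [a [b [aU bU aV bV VE]]] := sadjF exFd UF VF UV.
move: (UF) (VF); rewrite !inE => /andP[UF' eU] /andP[VF' eV].
have ga : g != a by apply: contraNneq aV => <-.
have gb : g != b by apply: contraNneq bU => <-.
have ab : a != b by apply: contraNneq bU => <-.
have eb : b != e by apply: contraNneq eV => <-.
have ge : g != e by apply: contraNneq eU => <-.
have af : a \in free F by apply/freeP; exists V.
have DU : (U :|: V) :\ g = swap U g b by rewrite VE setU_swap.
have UV' : U = swap V b a.
  rewrite VE; apply/setP => z; rewrite !inE; case: (eqVneq z a) => [->|za] //=.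
  by case: (eqVneq z b) => [->|] //=; rewrite (negPf bU).
have DV : (U :|: V) :\ g = swap V g a by rewrite setUC UV' setU_swap // -UV'.
(* Otherwise g, a, b, e span a U_{2,4} minor. *)
apply: contrapT => no.
have uniqU y : y \notin U -> swap U g y \in F -> y != e -> y = b.
  move=> yU SF ye; apply/eqP/negPn/negP => yb; apply: no; exists (swap U g y).
  rewrite sadj_swap // DU swap_neq //; split=> //.
  by rewrite !inE SF eqxx (negPf eU) andbF !orbF (eq_sym e) (eq_sym g) ye andbT /=;
     rewrite eq_sym; apply: contraNneq yU => <-.
have uniqV y : y \notin V -> swap V g y \in F -> y != e -> y = a.
  move=> yV SF ye; apply/eqP/negPn/negP => ya; apply: no; exists (swap V g y).
  rewrite [sadj V _]sadj_swap // orbT DV swap_neq //; split=> //.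
  by rewrite !inE SF eqxx (negPf eV) andbF !orbF (eq_sym e) (eq_sym g) ye andbT /=;
     rewrite eq_sym; apply: contraNneq yV => <-.
have gUf : g \in U :&: free F by rewrite in_setI gU gf.
have gVf : g \in V :&: free F by rewrite in_setI gV gf.
have Ugb : swap U g b \in F.
  have [y [yU SF ye]] := cosimple_other e csF UF' gUf.
  by rewrite -(uniqU y).
have Uge : swap U g e \in F.
  have [y [yU SF yb]] := cosimple_other b csF UF' gUf.
  case: (eqVneq y e) => [<-//|ye]; by rewrite (uniqU y) ?eqxx in yb.
have Vge : swap V g e \in F.
  have [y [yV SF ya]] := cosimple_other a csF VF' gVf.
  case: (eqVneq y e) => [<-//|ye]; by rewrite (uniqV y) ?eqxx in ya.
have aUf : a \in U :&: free F by rewrite in_setI aU af.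
(* A second exchange for a, besides b: y = e completes the excluded minor; otherwise exchanging g
   out of [swap U a y] contradicts [uniqU] or [uniqV]. *)
have [y [yU SF yb]] := cosimple_other b csF UF' aUf.
have [ye|ye] := eqVneq y e.
  apply: (noF U g a b e) => //; rewrite -?VE //.
  by rewrite -ye.
have ag : a != g by rewrite eq_sym.
have yg : y != g by apply: contraNneq yU => ->.
have ya : y != a by apply: contraNneq yU => ->.
have [z zD zF] : exists2 z, z \in swap U g b :\: swap U a y &
    z |: (swap U a y :\ g) \in F.
  apply: exF => //; rewrite !inE eqxx gU (negPf gb) !orbF /= andbT ga.
  by rewrite orbT.
have {zD} [za|zb] : z = a \/ z = b.
  move: zD; rewrite !inE; case: (eqVneq z b) => [->|zb] /=; first by right.
  case: (eqVneq z a) => [->|za] /=; first by left.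
  by rewrite negb_or => /andP[/andP[_ /negPf->]]; rewrite andbF.
- case/eqP: yb; apply: uniqU => //.
  suff -> : swap U g y = z |: (swap U a y :\ g) by [].
  rewrite za; apply/setP => w; rewrite !inE.
  case: (eqVneq w a) => [->|wa] /=; first by rewrite ag aU orbT.
  by case: (eqVneq w y) => [->|wy] //=; rewrite yg.
- case/eqP: ya; apply: uniqV => //; first by rewrite VE !inE negb_or yb (negPf yU) andbF.
  suff -> : swap V g y = z |: (swap U a y :\ g) by [].
  rewrite zb VE; apply/setP => w; rewrite !inE.
  case: (eqVneq w y) => [->|wy] /=; first by rewrite yg !orbT.
  by case: (eqVneq w b) => [->|wb] //=; rewrite eq_sym gb.
Qed.

Lemma leq_exp2_fact r : 2 ^ r <= 2 * r`!.
Proof.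
elim: r => // -[|r] IHr //; rewrite expnS factS.
by rewrite leq_mul2l /= (leq_trans IHr) // leq_mul2r ltnS orbT.
Qed.

(** A free element of A can be exchanged for something other than [e], so it stays free after the
    deletion. *)
Lemma cosimple_rank_fdel F A e : exchange F -> cosimple F -> A \in fdel F e ->
  #|A :&: free F| <= #|A :&: free (fdel F e)|.
Proof.
move=> exF csF; rewrite inE => /andP[AF eA]; apply: subset_leq_card.
apply/subsetP => x xAf; have /setIP[xA _] := xAf; rewrite in_setI xA /=.
have [y [yA SF ye]] := cosimple_other e csF AF xAf.
apply/freeP; exists (swap A x y).
  by rewrite !inE SF (eq_sym e) (negPf ye) (negPf eA) andbF.
by rewrite !inE eqxx orbF; apply: contraNneq yA => <-.
Qed.

Lemma cosimple_many r F X Y : exchange F -> cosimple F -> noU24 F ->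
  X \in F -> Y \in F -> sadj X Y -> r <= #|X :&: free F| ->
  many_hpaths F X Y ((r.-1)`! * 2 ^ 'C(r, 2)).
Proof.
elim: r F => [|[|r] IHr] F exF csF noF XF YF XY le_r; try exact: many_hpaths1.
have [|e [Xe Ye eF]] := common_free exF XF YF XY; first exact: leq_trans le_r.
have le_re : r.+1 <= #|X :&: free (fcon F e)|.
  by rewrite -ltnS (leq_trans le_r) // rank_fcon.
have exFe := exch_fcon exF (e := e).
have csFe := cosimple_fcon csF (c := e).
(* The factors come from induction on [fcon F e] in rank r+1, from 2(r+1) edges of its path, and
   from [squares_many] on [fdel F e] in rank r+2. *)
apply: (@many_hpathsW _ _ _ (r`! * 2 ^ 'C(r.+1, 2) * (2 * r.+1) * (r.+1)`!)).
  rewrite /= binS bin1 expnD.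
  have -> : r`! * 2 ^ 'C(r.+1, 2) * (2 * r.+1) * (r.+1)`! =
            (r.+1)`! * (2 ^ 'C(r.+1, 2) * (2 * (r.+1)`!)).
    by rewrite !factS; move: (2 ^ _) (r`!) => P f; lia.
  by rewrite !leq_mul2l leq_exp2_fact !orbT.
apply: (many_hpaths_mul (fdel_neq0 eF)).
- by apply: IHr => //; apply: noU24_sub noF; apply: fcon_sub.
- apply: leq_ltn_trans (rank_lt_card Xe (k := 2) _) => //.
    by rewrite leq_mul2l.
  by move=> x; apply: csFe.
move=> U V Ue Ve UV; move: (Ue) (Ve); rewrite !inE => /andP[UF eU] /andP[VF eV].
have [a [b [aU bU aV bV VE]]] := sadjF exF UF VF UV.
have eUf : e \in U :&: free F by rewrite in_setI eU.
(* Some exchange of [e] avoids the excluded set, so every edge carries a square. *)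
have [y [yU SF yb]] := cosimple_other b csF UF eUf.
have ZF : swap U e y \in fdel F e.
  by rewrite inE SF !inE eqxx orbF; apply: contraNneq yU => <-.
have nZ : swap U e y != (U :|: V) :\ e.
  rewrite VE setU_swap ?swap_neq //; by apply: contraNneq bU => <-.
have adjZ : sadj U (swap U e y) || sadj V (swap U e y) by rewrite sadj_swap.
have [U' [V' [UU VV U'F V'F UV']]] := square_ex exF Ue Ve UV ZF adjZ nZ.
exists U', V'; split=> //; apply: (@squares_many r.+2) => //.
- exact: exch_fdel.
- exact: cosimple_squares.
apply: leq_trans (cosimple_rank_fdel exF csF U'F).
rewrite (rank_const exF _ XF) //.
by apply: (subsetP (fdel_sub F e)).
Qed.
End Counting.

(** * From Hamiltonian paths to Hamiltonian cycles *)

Lemma set2_eq (T : finType) (x y u v : T) :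
  [set x; y] = [set u; v] -> (x = u /\ y = v) \/ (x = v /\ y = u).
Proof.
move=> eqS; have := set22 u v; have := set21 u v; have := set22 x y; have := set21 x y.
rewrite {1 2}eqS -{3 4}eqS !in_set2.
by do 4 (case/orP=> /eqP ?); subst; auto.
Qed.

Section HamiltonianCyclesFromPaths.
Variables (T : finType) (r : rel T) (X Y : T).
Implicit Types (s : seq T).

Definition cycle_edges s : {set {set T}} := [set [set x; next s x] | x in T].

Definition full_path s :=
  [/\ path r X s, uniq (X :: s), last X s = Y & forall x, x \in X :: s].

(** At i = [size s] the default value X of [nth] is the successor of the last vertex. *)
Lemma next_nth_uniq s i : uniq (X :: s) -> i <= size s ->
  next (X :: s) (nth X (X :: s) i) = nth X s i.
Proof. by move=> us le_i; rewrite next_nth mem_nth // index_uniq. Qed.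

(** Both orderings start at X and end at Y, which fixes the direction of the cycle; the vertices
    then agree one after another. *)
Lemma cycle_edges_inj s s' : 2 < #|T| -> full_path s -> full_path s' ->
  cycle_edges (X :: s) = cycle_edges (X :: s') -> s = s'.
Proof.
move=> gt2 [_ us ls fs] [_ us' ls' fs'] eqC.
have sz s1 : uniq (X :: s1) -> (forall x, x \in X :: s1) -> (size s1).+1 = #|T|.
  by move=> us1 fs1; rewrite -[LHS]/(size (X :: s1)) -(card_uniqP us1); apply: eq_card.
have szs := sz _ us fs; have szs' := sz _ us' fs'.
have ss' : size s = size s' by apply: succn_inj; rewrite szs szs'.
suff eqn k : k <= size s -> nth X (X :: s) k = nth X (X :: s') k.
  by apply: (@eq_from_nth _ X) => // i lt_i; apply: (eqn i.+1).
have [n] := ubnP k; elim: n k => // n IHn [//|k] lt_k le_k.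
have IH j : j <= k -> nth X (X :: s) j = nth X (X :: s') j.
  by move=> le_j; apply: IHn; [exact: leq_ltn_trans le_j lt_k | exact: leq_trans le_j (ltnW le_k)].
have ltk : k < size (X :: s) by rewrite /= ltnS ltnW.
have ltk' : k < size (X :: s') by rewrite /= -ss'.
have ltk1 : k.+1 < size (X :: s) by [].
have : [set nth X (X :: s) k; nth X (X :: s) k.+1] \in cycle_edges (X :: s').
  by rewrite -eqC; apply/imsetP; exists (nth X (X :: s) k); rewrite // next_nth_uniq.
case/imsetP=> z _; have /(nthP X)[j lt_j <-] := fs' z.
rewrite next_nth_uniq // => /set2_eq[] [eq1 eq2].
  rewrite (IH k) // in eq1; move/eqP: eq1; rewrite nth_uniq // => /eqP kj.
  by rewrite eq2 -kj.
(* The edge is traversed backwards: it is the preceding edge, which leads to an earlier vertex, or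
   the closing edge, which would leave only two vertices. *)
have [lt_js|ge_js] := ltnP j (size s').
  have /eqP : nth X (X :: s') k = nth X (X :: s') j.+1 by rewrite -IH.
  rewrite nth_uniq // => /eqP kj.
  have le_jk : j <= k by rewrite kj.
  move/eqP: eq2; rewrite -(IH j le_jk) nth_uniq //; last exact: leq_ltn_trans ltk.
  by move/eqP; lia.
have jE : j = size s' by apply/eqP; rewrite eqn_leq ge_js andbT -ltnS.
have /eqP : nth X (X :: s) k = nth X (X :: s) 0 by rewrite eq1 jE nth_default.
rewrite nth_uniq // => /eqP k0.
have /eqP : nth X (X :: s) k.+1 = nth X (X :: s) (size s).
  by rewrite eq2 jE -!last_nth ls.
by rewrite nth_uniq // k0 => /eqP s1; move: gt2; rewrite -szs -s1.
Qed.

Lemma full_path_hamiltonian s : 2 < #|T| -> r Y X -> full_path s ->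
  hamiltonian_cycle r (cycle_edges (X :: s)) /\ [set X; Y] \in cycle_edges (X :: s).
Proof.
move=> gt2 YX [ps us ls fs].
have szs : size (X :: s) == #|T|.
  by rewrite -(card_uniqP us); apply/eqP/eq_card.
split.
  apply/existsP; exists (Tuple szs); rewrite gt2 us eqxx andbT /=.
  by rewrite rcons_path ps ls.
apply/imsetP; exists Y => //.
by rewrite -{3}ls (last_nth X) next_nth_uniq // nth_default // setUC.
Qed.

Lemma leq_HC_edge (L : seq (seq T)) : 2 < #|T| -> r Y X -> uniq L ->
  {in L, forall s, full_path s} -> size L <= HC_edge r [set X; Y].
Proof.
move=> gt2 YX uL fL; pose C := map (fun s => cycle_edges (X :: s)) L.
have uC : uniq C.
  by rewrite map_inj_in_uniq // => s s' /fL fs /fL fs'; apply: cycle_edges_inj.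
rewrite -(size_map (fun s => cycle_edges (X :: s))) -/C -(card_uniqP uC).
apply/subset_leq_card/subsetP => _ /mapP[s /fL fs ->]; rewrite inE.
by have [-> ->] := full_path_hamiltonian gt2 YX fs.
Qed.

End HamiltonianCyclesFromPaths.

Lemma many_hpaths_HC_edge (E : finType) (M : matroid E) (X Y : basis M) k :
  2 < #|bases M| -> basis_adj X Y -> many_hpaths (bases M) (val X) (val Y) k ->
  k <= HC_edge (@basis_adj E M) [set X; Y].
Proof.
move=> gt2 XY [L [uL hL kL]]; apply: leq_trans kL _.
(* The default X of [insubd] is never taken, as the paths consist of bases. *)
pose g (s : seq {set E}) : seq (basis M) := map (insubd X) s.
have gK s : s \in L -> map val (g s) = s.
  move=> sL; rewrite -map_comp map_id_in // => A As /=.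
  by rewrite insubdK // -[_ \in _](hpath_mem (hL _ sL)) inE As orbT.
rewrite -(size_map g); apply: leq_HC_edge.
- by rewrite card_sig.
- by rewrite /basis_adj setUC.
- by rewrite map_inj_in_uniq // => s s' sL s'L eqg; rewrite -(gK s) // eqg gK.
move=> _ /mapP[s sL ->]; have /and4P[] := hL _ sL.
rewrite -{1 2 3}(gK s sL) => ps us /eqP ls _; split.
- by move: ps; rewrite path_map.
- by move: us; rewrite -map_cons map_inj_uniq //; apply: val_inj.
- by move: ls; rewrite last_map => /val_inj.
move=> Z; rewrite -(mem_map val_inj) map_cons gK //.
by rewrite (hpath_mem (hL _ sL)); apply: valP.
Qed.

(** * Cuts and spanning trees *)

Section SpanningTrees.
Variable G : mgraph.
Implicit Types (T F U : {set edge G}) (e f g : edge G) (x y u v : vertex G).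
Implicit Types (p q : vertex G -> bool).

(** Vertex sets are Boolean functions here, so that cuts can be added modulo 2. *)
Definition crosses p e := [exists x in ends e, exists y in ends e, p x != p y].

Lemma crossesE p e x y : ends e = [set x; y] -> crosses p e = (p x != p y).
Proof.
move=> ee; apply/existsP/idP => [[u /andP[ue /existsP[v /andP[ve]]]]|pxy].
  move: ue ve; rewrite ee !in_set2.
  by move=> /orP[]/eqP-> /orP[]/eqP->; rewrite ?eqxx // eq_sym.
exists x; rewrite ee set21 /=; apply/existsP; exists y.
by rewrite set22.
Qed.

(** This is the binary structure of graphs that rules out a U_{2,4} minor. *)
Lemma crosses_addb p q e :
  crosses (fun v => p v (+) q v) e = crosses p e (+) crosses q e.
Proof.
have [x [y [_ ee]]] := endsP e; rewrite !(crossesE _ ee).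
by case: (p x); case: (p y); case: (q x); case: (q y).
Qed.

Lemma uncrossed_const F p : spanning_connected F ->
  (forall f, f \in F -> ~~ crosses p f) -> forall x y, p x = p y.
Proof.
move=> cF nF x y; have /connectP[s ps ->] := cF x y.
elim: s x ps => //= z s IHs x /andP[/existsP[f /andP[fF /eqP ef]] /IHs <-].
by have := nF f fF; rewrite (crossesE _ ef) negbK => /eqP.
Qed.

(* Vertex sets avoiding r are determined by the edges of F that they cut. *)
Lemma leq_card_spanning F : spanning_connected F -> #|vertex G| <= #|F|.+1.
Proof.
move=> cF; have [V0|[r _]] := set_0Vmem [set: vertex G].
  by rewrite -cardsT V0 cards0.
pose cut (P : {set vertex G}) := [set f in F | crosses (fun v => v \in P) f].
have inj : {in powerset [set~ r] &, injective cut}.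
  move=> P Q; rewrite !powersetE => /subsetP rP /subsetP rQ /setP eqC.
  have nr (S : {set vertex G}) : {subset S <= [set~ r]} -> r \in S = false.
    by move=> rS; apply/negP => /rS; rewrite !inE eqxx.
  have nPQ f : f \in F -> ~~ crosses (fun v => (v \in P) (+) (v \in Q)) f.
    by move=> fF; move: (eqC f); rewrite crosses_addb !inE fF /= => ->; rewrite addbb.
  apply/setP => x; apply/eqP; rewrite -[_ == _]negbK negb_eqb.
  by rewrite (uncrossed_const cF nPQ x r) (nr _ rP) (nr _ rQ).
rewrite -cardsT (cardsD1 r) in_setT setTD add1n ltnS.
rewrite -(leq_exp2l _ _ (isT : 1 < 2)) -!card_powerset -(card_in_imset inj); apply/subset_leq_card/subsetP.
by move=> _ /imsetP[P _ ->]; rewrite powersetE; apply/subsetP => f; rewrite inE => /andP[].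
Qed.

(* p is the indicator function of one side of the fundamental cut of g. *)
Lemma side T g : T \in spanning_trees G -> g \in T ->
  exists p, [/\ crosses p g, forall f, f \in T -> f != g -> ~~ crosses p f &
    forall f, swap T g f \in spanning_trees G -> crosses p f].
Proof.
rewrite inE => /asboolP[cT /acyclicP aT] gT.
have [x [y [_ eg]]] := endsP g; have nxy := aT g x y gT eg.
pose p := connect (adj (T :\ g)) x; exists p.
have pT f : f \in T -> f != g -> ~~ crosses p f.
  move=> fT fg; have [u [v [_ ef]]] := endsP f.
  have uv : connect (adj (T :\ g)) u v.
    by apply: connect1; apply/existsP; exists f; rewrite !inE fg fT ef eqxx.
  by rewrite (crossesE _ ef) negbK /p (same_connect_r (@conn_sym _ _) uv).
have pg : crosses p g by rewrite (crossesE _ eg) /p connect0; apply/negP.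
split=> // f; rewrite inE => /asboolP[cS _]; apply: contraT => nf.
have pxy : p x = p y.
  apply: (uncrossed_const cS) => h; rewrite !inE => /predU1P[->//|/andP[hg hT]].
  exact: pT.
by move: pg; rewrite (crossesE _ eg) pxy eqxx.
Qed.

(* With p and q the sides of g and a in U, the function p (+) q is constant
   along the edges of the last tree but not along a. *)
Lemma spanning_trees_noU24 : noU24 (spanning_trees G).
Proof.
move=> U g a b e gU aU ga bU eU be UF Uab Ugb Uae Uge.
rewrite inE => /asboolP[cS _].
have [p [pg pU pS]] := side UF gU; have [q [qa qU qS]] := side UF aU.
have := uncrossed_const (p := fun v => p v (+) q v) cS.
have [x [y [_ ea]]] := endsP a.
move=> /(_ _ x y) const; move: qa (pU a aU); rewrite eq_sym ga => qa /(_ isT).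
have : ~~ crosses (fun v => p v (+) q v) a.
  rewrite (crossesE _ ea) negbK; apply/eqP/const => f.
  rewrite crosses_addb in_setU1 in_setD1 in_setU1 in_setD1.
  case/predU1P=> [->|/andP[fg /predU1P[->|/andP[fa fU]]]].
  - by rewrite (pS e) // (qS e).
  - by rewrite (pS b) // (qS b).
  - by rewrite (negPf (pU f fU fg)) (negPf (qU f fU fa)).
by rewrite crosses_addb qa => /negbTE; case: crosses.
Qed.

Lemma spanning_tree_in F : spanning_connected F ->
  exists2 T, T \in spanning_trees G & T \subset F.
Proof.
move=> cF.
have [T /minsetP[/asboolP cT minT] sTF] :
    {T | minset (fun T : {set edge G} => `[< spanning_connected T >]) T & T \subset F}.
  by apply: minset_exists; apply/asboolP.
exists T => //; rewrite inE; apply/asboolP; split=> //.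
apply/acyclicP => e x y eT ee cxy.
suff /minT/(_ (subD1set _ _))/setP/(_ e) : `[< spanning_connected (T :\ e) >].
  by rewrite !inE eqxx eT.
have cTe u : connect (adj (T :\ e)) x u.
  by have [//|] := connectD1 u cT ee; apply: connect_trans.
by apply/asboolP => u v; apply: connect_trans (cTe v); rewrite conn_sym.
Qed.

Lemma spanning_trees_free k : 1 < k -> k_edge_connected G k ->
  free (spanning_trees G) = setT.
Proof.
move=> k1 [_ kG]; apply/setP => e; rewrite in_setT; apply/freeP.
have [|T TF sT] := @spanning_tree_in (~: [set e]); first by apply: kG; rewrite cards1.
by exists T => //; apply/negP => /(subsetP sT); rewrite !inE eqxx.
Qed.

(** If [g] had at most one exchange, G would stay connected without both edges; exchanging [g]
    towards a tree of the rest gives another one. *)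
Lemma spanning_trees_cosimple : k_edge_connected G 3 -> cosimple (spanning_trees G).
Proof.
move=> [_ kG] T g TF /setIP[gT _]; rewrite ltnNge; apply/negP => le1.
set Y := [set y | _] in le1.
have [|T' T'F sT'] := @spanning_tree_in (~: (g |: Y)).
  by apply: kG; rewrite cardsU1; case: (g \notin Y); rewrite ?add1n ?add0n !ltnS // ltnW.
have [|f fD SF] := spanning_trees_exchange TF T'F (e := g).
  rewrite inE gT andbT; apply/negP => /(subsetP sT').
  by rewrite !inE eqxx.
move: fD; rewrite inE => /andP[fT /(subsetP sT')].
by rewrite in_setC in_setU1 inE fT SF orbT.
Qed.

End SpanningTrees.

(** * The bound for cycle matroids *)

Lemma cycle_matroid_HC_edge (G : mgraph) (cG : mg_connected G)
    (X Y : basis (cycle_matroid cG)) :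
  k_edge_connected G 3 -> 2 < #|vertex G| -> basis_adj X Y ->
  (#|vertex G| - 2)`! * 2 ^ 'C(#|vertex G| - 1, 2) <=
    HC_edge (@basis_adj _ (cycle_matroid cG)) [set X; Y].
Proof.
move=> kG n3 XY; have XF := valP X; have YF := valP Y.
have freeT := spanning_trees_free (isT : 1 < 3) kG.
have csG := spanning_trees_cosimple kG.
have rk : #|vertex G| - 1 <= #|val X :&: free (spanning_trees G)|.
  rewrite freeT setIT leq_subLR add1n; apply: leq_card_spanning.
  by move: XF; rewrite inE => /asboolP[].
apply: many_hpaths_HC_edge => //.
  (* The rank is positive and each element has two exchanges, so there are more than 2 bases, as a
     Hamiltonian cycle requires. *)
  apply: leq_ltn_trans (rank_lt_card (k := 2) XF _); last by move=> x; apply: csG.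
  by rewrite -[leqLHS]muln1 leq_mul2l /= (leq_trans _ rk) // subn_gt0 ltnW.
have -> : #|vertex G| - 2 = (#|vertex G| - 1).-1 by lia.
apply: cosimple_many => //; first exact: spanning_trees_exchange.
exact: spanning_trees_noU24.
Qed.

(** Without an edge, [HC_star] would take its default value 0. *)
Lemma basis_graph_edge (G : mgraph) (cG : mg_connected G) :
  k_edge_connected G 3 ->
  exists X Y : basis (cycle_matroid cG), basis_adj X Y.
Proof.
move=> kG; have [T TF] := set0Pn _ (spanning_trees_neq0 cG).
have cT : spanning_connected T by move: (TF); rewrite inE => /asboolP[].
have /card_gt0P[e eT] : 0 < #|T|.
  by rewrite -ltnS; apply: leq_trans (leq_card_spanning cT); case: kG.
have exG := @spanning_trees_exchange G.
have [|y yT SF] := free_swap exG TF eT.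
  by rewrite (spanning_trees_free (isT : 1 < 3) kG).
exists (Sub T TF), (Sub (swap T e y) SF).
exact: (sadj_swap eT yT).
Qed.

Lemma nat_min_geq (P : nat -> Prop) k :
  (exists n, P n) -> (forall n, P n -> k <= n) -> k <= nat_min P.
Proof. by move=> /nat_minP[Pm _] kP; apply: kP. Qed.

Lemma k_edge_connected_exists n : 1 < n ->
  exists2 G : mgraph, k_edge_connected G 3 & #|vertex G| = n.
Proof.
move=> n1.
(* Each ordered pair of distinct vertices carries three parallel edges, so removing two edges leaves
   all vertices pairwise adjacent. *)
pose edgeT : finType := {p : 'I_n * 'I_n * 'I_3 | p.1.1 != p.1.2}.
pose endsT (e : edgeT) := [set (val e).1.1; (val e).1.2].
have cardT e : #|endsT e| = 2 by rewrite cards2 (valP e).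
exists (MGraph cardT); last by rewrite /= card_ord.
split; first by rewrite /= card_ord.
move=> F ltF x y; have [->|nxy] := eqVneq x y; first exact: connect0.
pose f (i : 'I_3) : edgeT := Sub (x, y, i) nxy.
have injf : injective f by move=> i j /(congr1 val)[].
have /subsetPn[_ /imsetP[i _ ->] iF] : ~~ ([set f i | i in 'I_3] \subset F).
  apply: contraTN ltF => /subset_leq_card; rewrite card_imset // card_ord.
  by rewrite -leqNgt.
by apply: connect1; apply/existsP; exists (f i); rewrite inE iF /= /endsT.
Qed.

Theorem theorem2p18 (n : nat) (hn : 3 <= n) :
  (n - 2)`! * 2 ^ 'C(n - 1, 2) <= hc n 3.
Proof.
apply: nat_min_geq.
  have [G kG nG] := k_edge_connected_exists (ltnW hn).
  by exists (HC_star (cycle_matroid (k_edge_connectedW (isT : 0 < 3) kG))), G; eexists.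
move=> _ [G [cG [kG nG ->]]]; apply: nat_min_geq.
  have [X [Y XY]] := basis_graph_edge cG kG.
  eexists; exists [set X; Y] => //.
  by apply/imsetP; exists (X, Y); rewrite ?inE.
move=> _ [_ /imsetP[[X Y] + ->] ->]; rewrite inE -nG => XY.
by apply: cycle_matroid_HC_edge => //; rewrite nG.
Qed.
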